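(* Let $S\subseteq\mathbb{R}^n$ be closed. For every $x\in S$ and every $d\in T_S(x)$ one has $$T_{T_S(x)}(d)+\widehat T_S(x;d)=T_{T_S(x)}(d),\qquad T^2_S(x;d)+\widehat T_S(x;d)=T^2_S(x;d).$$
   Context: For $x\in S$, $T_S(x):=\{d: \exists t_k\downarrow0,\ d_k\to d,\ x+t_kd_k\in S\}$ is the tangent (contingent) cone. For $d\in T_S(x)$, the outer second-order tangent set is $T^2_S(x;d):=\{w:\exists t_k\downarrow 0,\ w_k\to w,\ x+t_kd+\tfrac12t_k^2w_k\in S\}$ (possibly empty). The directional regular (Clarke) tangent cone to $S$ at $x$ in direction $d$ is $$\widehat T_S(x;d):=\{v:\ \forall t_k\downarrow0,\ d_k\to d\text{ with }x+t_kd_k\in S,\ \exists v_k\to v\text{ with }v_k\in T_S(x+t_kd_k)\}.$$ Sums are Minkowski sums. *)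

(* Defs.v *)
From mathcomp Require Export all_boot all_order all_algebra.
From mathcomp Require Export all_classical all_reals all_analysis.

Set Implicit Arguments.
Unset Strict Implicit.
Unset Printing Implicit Defensive.

Import Order.TTheory GRing.Theory Num.Theory.
Import numFieldNormedType.Exports.

Local Open Scope classical_set_scope.
Local Open Scope ring_scope.

(* The sequences t_k "decreasing to 0": as usual in variational analysis,
   positive and convergent to 0, not necessarily monotone. *)
Definition downto0 (R : realType) (t : nat -> R) : Prop :=
  (forall k, 0 < t k) /\ t @ \oo --> 0.

(* The sets below are defined at every x and d; the cones and the second-order
   set are only meant for x in S and d in tangent_cone S x. The topology of
   'rV[R]_n is that of the sup norm, i.e. the Euclidean one. *)
Definition tangent_cone (R : realType) (n : nat) (S : set 'rV[R]_n)
    (x : 'rV[R]_n) : set 'rV[R]_n :=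
  [set d | exists (t : nat -> R) (d_ : nat -> 'rV[R]_n),
     [/\ downto0 t, d_ @ \oo --> d & forall k, S (x + t k *: d_ k)]].

Definition second_order_tangent_set (R : realType) (n : nat)
    (S : set 'rV[R]_n) (x d : 'rV[R]_n) : set 'rV[R]_n :=
  [set w | exists (t : nat -> R) (w_ : nat -> 'rV[R]_n),
     [/\ downto0 t, w_ @ \oo --> w &
         forall k, S (x + t k *: d + (2^-1 * t k ^+ 2) *: w_ k)]].

Definition dir_regular_tangent_cone (R : realType) (n : nat)
    (S : set 'rV[R]_n) (x d : 'rV[R]_n) : set 'rV[R]_n :=
  [set v | forall (t : nat -> R) (d_ : nat -> 'rV[R]_n),
     downto0 t -> d_ @ \oo --> d -> (forall k, S (x + t k *: d_ k)) ->
     exists v_ : nat -> 'rV[R]_n,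
       v_ @ \oo --> v /\ forall k, tangent_cone S (x + t k *: d_ k) (v_ k)].

Definition minkowski_sum (R : realType) (n : nat) (A B : set 'rV[R]_n) :
    set 'rV[R]_n :=
  [set a + b | a in A & b in B].

(* Main.v *)
Require Import Defs.
From mathcomp Require Import all_boot all_order all_algebra.
From mathcomp Require Import all_classical all_reals all_analysis.
From mathcomp Require Import ring lra.
Import Order.TTheory GRing.Theory Num.Theory.
Import numFieldNormedType.Exports.
Local Open Scope classical_set_scope.
Local Open Scope ring_scope.

(** The absorption rests on one fact about the directional regular tangent cone,
    [dir_regular_shift]: if [v] is a regular tangent in direction [d], then from
    every point [y = x + t *: d'] of [S] with [t] small and [d'] close to [d],
    and for every step [s] small relative to [t], the set [S] contains a point
    [y + s *: v'] with [v'] as close to [v] as desired, uniformly in [y] and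
    [s].

    That fact has two ingredients. First, negating quantifiers turns the
    sequential definition of the cone into a uniform one: at all points of [S]
    in a small directional neighbourhood of [x], some tangent vector is within
    [e] of [v] ([dir_regular_uniform]). Second, in a closed set one can travel
    along approximate tangents ([follow_near_tangents]). Among the times [s] at
    which [S] comes within [e * s] of [y + s *: v] there is a largest one, by
    compactness; were it smaller than the prescribed time, the tangent vector
    close to [v] at the point reached would allow a little more progress. The
    travel remains in the directional neighbourhood because its length is
    [O(s)] and [s] is small relative to [t].

    With the shift available, both identities are bookkeeping.
    - For a second-order tangent [w], the point
      [x + t *: d + (t ^+ 2 / 2) *: w'] is [x + t *: d'] with
      [d' = d + (t / 2) *: w'], and the step [s = t ^+ 2 / 2] is small relative
      to [t]; shifting turns [w'] into [w' + v'].
    - For [u] tangent to [T_S(x)] at [d], the vector [d + t *: u'] lies in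
      [T_S(x)], so that [S] contains points [x + tau *: g] with [g] tending to
      [d + t *: u'] as [tau] tends to 0. Shifting by [s = tau * t] replaces [g]
      by [g + t *: v']; a cluster value of these as [tau] tends to 0 is in
      [T_S(x)] and close to [d + t *: (u + v)].
    The reverse inclusions hold because 0 is a regular tangent.

    All sequential definitions are handled through the epsilon form of
    [downto0_seqP]. *)

(** * Vanishing sequences and cluster values *)

(** Turns every tangent-type set into an epsilon statement: tangent cones,
    second-order tangent sets and the negation of regularity are all of this
    shape, for different predicates [P]. *)
Lemma downto0_seqP {R : realType} {V : normedModType R}
    (P : R -> V -> Prop) (w : V) :
  (exists (t : nat -> R) (w_ : nat -> V),
     [/\ downto0 t, w_ @ \oo --> w & forall k, P (t k) (w_ k)]) <->
  (forall e, 0 < e ->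
     exists t w', [/\ 0 < t, t < e, `|w' - w| < e & P t w']).
Proof.
split=> [[t [w_ [[t0 tto0] wcv Pk]]] e e0|H].
  have /cvgrPdist_lt/(_ e e0) tN := tto0.
  have /cvgrPdist_lt/(_ e e0) wN := wcv.
  have [k [tk wk]] := filter_ex (filterI tN wN).
  exists (t k), (w_ k); split=> //; last by rewrite distrC.
  by move: tk; rewrite /= sub0r normrN gtr0_norm.
have step (k : nat) : exists tw : R * V,
    [/\ 0 < tw.1, tw.1 < k.+1%:R^-1, `|tw.2 - w| < k.+1%:R^-1
      & P tw.1 tw.2].
  have k0 : (0 : R) < k.+1%:R^-1 by rewrite invr_gt0.
  by have [t [w' ?]] := H _ k0; exists (t, w').
have [f fP] := choice step.
exists (fst \o f), (snd \o f); split=> [|| k]; last by have [] := fP k.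
- split=> [k|]; first by have [] := fP k.
  apply/cvgrPdist_lt => e e0.
  apply: filterS (near_infty_natSinv_lt (PosNum e0)) => k /= ke.
  have [t0 tk _ _] := fP k.
  by rewrite sub0r normrN gtr0_norm //; apply: lt_trans ke.
- apply/cvgrPdist_lt => e e0.
  apply: filterS (near_infty_natSinv_lt (PosNum e0)) => k /= ke.
  have [_ _ wk _] := fP k.
  by rewrite distrC; apply: lt_trans ke.
Qed.

Lemma tangent_coneP {R : realType} {n : nat} (S : set 'rV[R]_n)
    (x d : 'rV[R]_n) :
  tangent_cone S x d <->
  (forall e, 0 < e ->
     exists t d', [/\ 0 < t, t < e, `|d' - d| < e & S (x + t *: d')]).
Proof. exact: (downto0_seqP (fun t d' => S (x + t *: d'))). Qed.

Lemma second_order_tangent_setP {R : realType} {n : nat} (S : set 'rV[R]_n)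
    (x d w : 'rV[R]_n) :
  second_order_tangent_set S x d w <->
  (forall e, 0 < e ->
     exists t w', [/\ 0 < t, t < e, `|w' - w| < e &
                      S (x + t *: d + (2^-1 * t ^+ 2) *: w')]).
Proof.
exact: (downto0_seqP (fun t w' => S (x + t *: d + (2^-1 * t ^+ 2) *: w'))).
Qed.

(** Bolzano-Weierstrass for families indexed by arbitrarily small times; this is
    the only place where finite dimension enters. The conclusion has the shape
    of [downto0_seqP]. *)
Lemma bounded_cluster {R : realType} {n : nat}
    (P : R -> 'rV[R]_n -> Prop) (c : 'rV[R]_n) (r : R) :
  (forall e, 0 < e -> exists t w, [/\ 0 < t, t < e, `|w - c| <= r & P t w]) ->
  exists2 w0, `|w0 - c| <= r &
    forall e, 0 < e -> exists t w, [/\ 0 < t, t < e, `|w - w0| < e & P t w].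
Proof.
move=> H.
have step (k : nat) : exists tw : R * 'rV[R]_n,
    [/\ 0 < tw.1, tw.1 < k.+1%:R^-1, `|tw.2 - c| <= r & P tw.1 tw.2].
  have k0 : (0 : R) < k.+1%:R^-1 by rewrite invr_gt0.
  by have [t [w' ?]] := H _ k0; exists (t, w').
have [f fP] := choice step.
pose B := [set w : 'rV[R]_n | `|c - w| <= r].
have Bbound : bounded_set B.
  exists (`|c| + r); split; first by rewrite num_real.
  move=> M ltM w Bw; apply/ltW; apply: le_lt_trans ltM.
  have := ler_normD c (w - c); rewrite subrKC distrC => h.
  by apply: le_trans h _; rewrite lerD2l.
have Bclosed : closed B by exact: closed_closed_ball_.
have uB : ((snd \o f) @ \oo) B.
  by exists 0%N => // k _; rewrite /B /= distrC; have [] := fP k.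
have [w0 [Bw0 clw0]] := bounded_closed_compact Bbound Bclosed _ uB.
exists w0 => [|e e0]; first by rewrite distrC.
have Nw0 : nbhs w0 (ball w0 e) by exact: nbhsx_ballx.
pose A := [set w | exists t, [/\ 0 < t, t < e & P t w]].
have FA : ((snd \o f) @ \oo) A.
  apply: filterS (near_infty_natSinv_lt (PosNum e0)) => k /= ke.
  have [t0 tk _ Pk] := fP k.
  by exists (f k).1; split=> //; apply: lt_trans ke.
have [w [[t [t0 te Pw]]]] := clw0 _ _ FA Nw0.
rewrite -ball_normE /= => w0w.
by exists t, w; split=> //; rewrite distrC.
Qed.

Lemma closedP_dist {R : realType} {V : normedModType R} (S : set V) (z0 : V) :
  closed S -> (forall e, 0 < e -> exists2 z, S z & `|z - z0| < e) -> S z0.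
Proof.
move=> clS H; apply: clS => N /nbhs_normP [e /= e0 eN].
have [z Sz zz0] := H _ e0.
by exists z; split=> //; apply: eN; rewrite /= distrC.
Qed.

(** * Travelling in a closed set along approximate tangents *)

(** A continuity argument on the reachable times. The drift allowed at time [s]
    is [e * s], so a tangent direction [w] with [`|w - v| < e] at the last point
    reached extends the reachable times further. Reachable times may form a
    disconnected set: only its maximum matters, which spares any selection of a
    path in [S]. *)
Lemma follow_near_tangents {R : realType} {n : nat} (S : set 'rV[R]_n)
    (y v : 'rV[R]_n) (e s0 : R) :
  closed S -> S y -> 0 < e -> 0 <= s0 ->
  (forall z, S z -> `|z - y| <= (`|v| + e) * s0 ->
     exists2 w, tangent_cone S z w & `|w - v| < e) ->
  exists2 z, S z & `|z - (y + s0 *: v)| <= e * s0.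
Proof.
move=> clS Sy e0 s00 H.
pose reach s z := S z /\ `|z - (y + s *: v)| <= e * s.
have reach_bound s z : 0 <= s -> s <= s0 -> reach s z ->
    `|z - y| <= (`|v| + e) * s0.
  move=> sge0 les [_ zs].
  have -> : z - y = (z - (y + s *: v)) + s *: v.
    by apply/rowP => i; rewrite !mxE; ring.
  have := ler_normD (z - (y + s *: v)) (s *: v).
  rewrite normrZ ger0_norm // => h.
  have := normr_ge0 v; nra.
pose A := [set s | [/\ 0 <= s, s <= s0 & exists z, reach s z]].
have A0 : A 0.
  by split=> //; exists y; split=> //; rewrite scale0r addr0 subrr normr0 mulr0.
have Aub : has_ubound A by exists s0 => s [].
have As : has_sup A by split; first by exists 0.
pose sm := sup A.
have sm0 : 0 <= sm by exact: ub_le_sup Aub _ A0.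
have sms0 : sm <= s0 by apply: sup_le_ub; [exists 0 | move=> s []].
(* The supremum is attained: points reached at times close to it cluster. *)
have [z [Sz zsm]] : exists z, reach sm z.
  pose P t z := exists s, [/\ 0 <= s, sm - t < s, s <= sm & reach s z].
  have [|z _ zP] := @bounded_cluster R n P y ((`|v| + e) * s0).
    move=> t t0; have t20 : 0 < t / 2 by rewrite divr_gt0.
    have [s [sge0 les [z zs]] lts] := sup_adherent t20 As.
    exists (t / 2), z; split=> //; first lra.
      exact: reach_bound zs.
    exists s; split=> //; apply: ub_le_sup Aub _ _.
    by split=> //; exists z.
  exists z; split.
    apply: closedP_dist clS _ => t t0.
    by have [_ [z' [_ _ z'z [_ [_ _ _ [Sz' _]]]]]] := zP t t0; exists z'.
  apply/ler_addgt0Pr => t t0.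
  (* Both the distance to a reached point and the time gap are below t / K; the
     choice of K makes their joint contribution, t / K * (1 + |v|), equal t. *)
  pose K := 1 + `|v|; have K0 : 0 < K by rewrite ltr_pwDl.
  have tK0 : 0 < t / K by rewrite divr_gt0.
  have [tau [z' [tau0 taut z'z [s [sge0 lts les [Sz' z's]]]]]] := zP _ tK0.
  have -> : z - (y + sm *: v) =
      (z - z') + (z' - (y + s *: v)) + (s - sm) *: v.
    by apply/rowP => i; rewrite !mxE; ring.
  apply: le_trans (ler_normD _ _) _.
  have h1 := ler_normD (z - z') (z' - (y + s *: v)).
  rewrite (distrC z z') in h1.
  have h2 : `|(s - sm) *: v| <= t / K * `|v|.
    rewrite normrZ; apply: ler_wpM2r => //.
    by rewrite ler_norml; apply/andP; split; lra.
  have h3 : t = t / K + t / K * `|v|.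
    by rewrite -[X in X + _]mulr1 -mulrDr divfK ?gt_eqF.
  have : e * s <= e * sm by rewrite ler_pM2l.
  lra.
have [ltsm|gesm] := ltP sm s0; last first.
  by exists z => //; rewrite (_ : s0 = sm) //; lra.
have [w Tw wv] : exists2 w, tangent_cone S z w & `|w - v| < e.
  by apply: H => //; apply: (@reach_bound sm).
(* Time left before s0, and slack of w in the drift allowance. *)
pose m := Num.min (s0 - sm) (e - `|w - v|).
have m0 : 0 < m by rewrite lt_min !subr_gt0 ltsm.
have [t [w' [t0 tm w'w St]]] := (tangent_coneP _ _ _).1 Tw m m0.
move: tm w'w; rewrite !lt_min => /andP[ts _] /andP[_ w'w].
suff : A (sm + t) by move=> /(ub_le_sup Aub); rewrite -/sm; lra.
split; [lra | lra |].
exists (z + t *: w'); split=> //.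
have -> : z + t *: w' - (y + (sm + t) *: v) =
   (z - (y + sm *: v)) + t *: ((w' - w) + (w - v)).
  by apply/rowP => i; rewrite !mxE; ring.
apply: le_trans (ler_normD _ _) _.
rewrite normrZ gtr0_norm //.
have h : `|w' - w + (w - v)| <= e.
  by apply: le_trans (ler_normD _ _) _; lra.
have : t * `|w' - w + (w - v)| <= t * e by rewrite ler_pM2l.
lra.
Qed.

(** * Uniform consequences of directional regularity *)

(** If no [delta] worked, points violating the bound would exist at every scale;
    [downto0_seqP] makes a sequence of them, which contradicts the sequential
    definition. *)
Lemma dir_regular_uniform {R : realType} {n : nat} (S : set 'rV[R]_n)
    (x d v : 'rV[R]_n) (e : R) :
  dir_regular_tangent_cone S x d v -> 0 < e ->
  exists2 delta, 0 < delta & forall t d', 0 < t -> t < delta ->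
    `|d' - d| < delta -> S (x + t *: d') ->
    exists2 w, tangent_cone S (x + t *: d') w & `|w - v| < e.
Proof.
move=> Tv e0; apply: contrapT => nodelta.
pose bad t d' := S (x + t *: d') /\
  forall w, tangent_cone S (x + t *: d') w -> ~ `|w - v| < e.
have /downto0_seqP [t [d_ [t0 dd bad_td]]] : forall delta, 0 < delta ->
    exists t d', [/\ 0 < t, t < delta, `|d' - d| < delta & bad t d'].
  move=> delta delta0; apply: contrapT => nobad; apply: nodelta.
  exists delta => // t d' t0 td dd' St; apply: contrapT => now.
  apply: nobad; exists t, d'; split=> //; split=> // w Tw wv.
  by apply: now; exists w.
have [v_ [vv Tv_]] := Tv t d_ t0 dd (fun k => (bad_td k).1).
have /cvgrPdist_lt/(_ e e0) vN := vv.
have [k vk] := filter_ex vN.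
by apply: ((bad_td k).2 _ (Tv_ k)); rewrite distrC.
Qed.

(** The points visited from [x + t *: d'] up to time [s <= delta * t] are within
    [(`|v| + e) * delta * t], so they are [x + t *: q] with [q] within
    [(`|v| + e) * delta] of [d']: [dir_regular_uniform] applies throughout
    the travel. *)
Lemma dir_regular_shift {R : realType} {n : nat} (S : set 'rV[R]_n)
    (x d v : 'rV[R]_n) (e : R) :
  closed S -> dir_regular_tangent_cone S x d v -> 0 < e ->
  exists2 delta, 0 < delta & forall t d' s, 0 < t -> t < delta ->
    `|d' - d| < delta -> S (x + t *: d') -> 0 < s -> s <= delta * t ->
    exists2 v', `|v' - v| <= e & S (x + t *: d' + s *: v').
Proof.
move=> clS Tv e0.
have [delta0 delta00 near_tangent] := dir_regular_uniform _ _ _ _ _ Tv e0.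
pose M := `|v| + e; have M0 : 0 < M by rewrite ltr_wpDl.
(* delta for d' - d and M * delta for q - d' add up to delta0. *)
pose delta := delta0 / (1 + M).
have deltaE : delta + M * delta = delta0.
  by rewrite /delta; field; rewrite gt_eqF // ltr_wpDl // ltW.
have delta_gt0 : 0 < delta by rewrite divr_gt0 // ltr_wpDl // ltW.
exists delta => // t d' s t0 tdelta dd' Sy s0 st.
have [||z Sz zy] := follow_near_tangents S (x + t *: d') v e s clS Sy e0.
- exact: ltW.
- move=> z Sz zy.
  pose q := d' + t^-1 *: (z - (x + t *: d')).
  have tn0 : t != 0 by rewrite gt_eqF.
  have zE : z = x + t *: q.
    by apply/rowP => i; rewrite !mxE; field.
  rewrite zE; apply: near_tangent; rewrite -?zE //.
    by apply: lt_trans tdelta _; rewrite -deltaE ltrDl mulr_gt0.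
  have -> : q - d = (d' - d) + t^-1 *: (z - (x + t *: d')).
    by apply/rowP => i; rewrite !mxE; ring.
  apply: le_lt_trans (ler_normD _ _) _.
  rewrite -deltaE; apply: ltr_leD => //.
  rewrite normrZ gtr0_norm ?invr_gt0 // mulrC ler_pdivrMr //.
  by apply: le_trans zy _; rewrite -/M -mulrA ler_pM2l.
have sn0 : s != 0 by rewrite gt_eqF.
exists (v + s^-1 *: (z - (x + t *: d' + s *: v))).
  rewrite addrAC subrr add0r normrZ gtr0_norm ?invr_gt0 // mulrC.
  by rewrite ler_pdivrMr.
suff -> : x + t *: d' + s *: (v + s^-1 *: (z - (x + t *: d' + s *: v))) = z.
  by [].
by apply/rowP => i; rewrite !mxE; field.
Qed.

(** * Absorption of regular tangents *)

(** The shift is applied at points [x + tau *: g], with [g] close to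
    [d + t *: u'], and steps [tau * t]: the scale [t] of the outer tangent cone
    is fixed first and bounds the relative step, while [tau] tends to 0. *)
Lemma tangent_tangent_add {R : realType} {n : nat} (S : set 'rV[R]_n)
    (x d u v : 'rV[R]_n) :
  closed S -> tangent_cone (tangent_cone S x) d u ->
  dir_regular_tangent_cone S x d v ->
  tangent_cone (tangent_cone S x) d (u + v).
Proof.
move=> clS Tu Tv; apply/tangent_coneP => e e0.
have e4 : 0 < e / 4 by rewrite divr_gt0.
have [delta delta0 shift] := dir_regular_shift _ _ _ _ _ clS Tv e4.
pose K := 1 + `|u|; have K0 : 0 < K by rewrite ltr_pwDl.
pose m := Num.min (Num.min (e / 4) 1) (Num.min delta (delta / 2 / K)).
have m0 : 0 < m by rewrite !lt_min e4 ltr01 delta0 !divr_gt0.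
have [t [u' [t0 tm u'u Tt]]] := (tangent_coneP _ _ _).1 Tu m m0.
move: tm u'u; rewrite !lt_min => /andP[/andP[te t1] /andP[td tK]].
move=> /andP[/andP[u'e u'1] _].
have tu' : `|t *: u'| < delta / 2.
  rewrite normrZ gtr0_norm //.
  have u'K : `|u'| <= K.
    rewrite -[u'](subrK u); apply: le_trans (ler_normD _ _) _.
    by rewrite /K lerD2r ltW.
  have : t * K < delta / 2 by rewrite -ltr_pdivlMr.
  by apply: le_lt_trans; rewrite ler_pM2l.
(* The shifted directions stay in a ball of radius t * (e / 2): an error of
   t * (e / 4) comes from v' and as much from g. *)
have [|f0 f0c Tf0] := @bounded_cluster R n (fun tau f => S (x + tau *: f))
    (d + t *: u' + t *: v) (t * (e / 2)).
  move=> e1 e10.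
  pose m1 := Num.min (Num.min e1 delta) (Num.min (delta / 2) (t * (e / 4))).
  have m10 : 0 < m1 by rewrite !lt_min e10 delta0 divr_gt0 // mulr_gt0.
  have [tau [g [tau0 taum gd Sg]]] := (tangent_coneP _ _ _).1 Tt m1 m10.
  move: taum gd; rewrite !lt_min => /andP[/andP[taue taud] _].
  move=> /andP[_ /andP[gdelta ge]].
  have [|||v' v'v Sv'] := shift tau g (tau * t) tau0 taud _ Sg.
  - have -> : g - d = (g - (d + t *: u')) + t *: u'.
      by apply/rowP => i; rewrite !mxE; ring.
    by apply: le_lt_trans (ler_normD _ _) _; lra.
  - exact: mulr_gt0.
  - by rewrite mulrC ler_pM2r // ltW.
  exists tau, (g + t *: v'); split=> //; last first.
    by rewrite scalerDr scalerA addrA.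
  have -> : g + t *: v' - (d + t *: u' + t *: v) =
      (g - (d + t *: u')) + t *: (v' - v).
    by apply/rowP => i; rewrite !mxE; ring.
  apply: le_trans (ler_normD _ _) _.
  rewrite normrZ gtr0_norm //.
  have : t * `|v' - v| <= t * (e / 4) by rewrite ler_pM2l.
  lra.
have tn0 : t != 0 by rewrite gt_eqF.
exists t, (t^-1 *: (f0 - d)); split=> //; first lra.
  have -> : t^-1 *: (f0 - d) - (u + v) =
      t^-1 *: (f0 - (d + t *: u' + t *: v)) + (u' - u).
    by apply/rowP => i; rewrite !mxE; field.
  apply: le_lt_trans (ler_normD _ _) _.
  rewrite normrZ gtr0_norm ?invr_gt0 // mulrC.
  have : `|f0 - (d + t *: u' + t *: v)| / t <= e / 2.
    by rewrite ler_pdivrMr // mulrC.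
  lra.
by rewrite scalerA mulfV // scale1r subrKC; apply/tangent_coneP.
Qed.

(** The second-order term is absorbed into the direction [d], which leaves
    [t ^+ 2 / 2] as the step of the shift, negligible compared with [t]. *)
Lemma second_order_add {R : realType} {n : nat} (S : set 'rV[R]_n)
    (x d w v : 'rV[R]_n) :
  closed S -> second_order_tangent_set S x d w ->
  dir_regular_tangent_cone S x d v ->
  second_order_tangent_set S x d (w + v).
Proof.
move=> clS Tw Tv; apply/second_order_tangent_setP => e e0.
have e2 : 0 < e / 2 by rewrite divr_gt0.
have [delta delta0 shift] := dir_regular_shift _ _ _ _ _ clS Tv e2.
pose K := 1 + `|w|; have K0 : 0 < K by rewrite ltr_pwDl.
pose m := Num.min (Num.min (e / 2) 1) (Num.min delta (delta / K)).
have m0 : 0 < m by rewrite !lt_min e2 ltr01 delta0 divr_gt0.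
have [t [w' [t0 tm w'w St]]] := (second_order_tangent_setP _ _ _ _).1 Tw m m0.
move: tm w'w; rewrite !lt_min => /andP[/andP[te t1] /andP[td tK]].
move=> /andP[/andP[w'e w'1] _].
have yE : x + t *: d + (2^-1 * t ^+ 2) *: w' = x + t *: (d + (2^-1 * t) *: w').
  by apply/rowP => i; rewrite !mxE; ring.
rewrite yE in St.
have s0 : 0 < 2^-1 * t ^+ 2 by rewrite mulr_gt0 ?invr_gt0 ?exprn_gt0.
have [||v' v'v Sv'] := shift t _ (2^-1 * t ^+ 2) t0 td _ St s0.
- rewrite addrAC subrr add0r normrZ gtr0_norm ?mulr_gt0 ?invr_gt0 //.
  have w'K : `|w'| <= K.
    rewrite -[w'](subrK w); apply: le_trans (ler_normD _ _) _.
    by rewrite /K lerD2r ltW.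
  have : t * K < delta by rewrite -ltr_pdivlMr.
  have : t * `|w'| <= t * K by rewrite ler_pM2l.
  have : 0 <= t * `|w'| by rewrite mulr_ge0 // ltW.
  lra.
- rewrite expr2 mulrA ler_pM2r //; lra.
exists t, (w' + v'); split=> //; first lra.
  have -> : w' + v' - (w + v) = (w' - w) + (v' - v).
    by apply/rowP => i; rewrite !mxE; ring.
  by apply: le_lt_trans (ler_normD _ _) _; lra.
by rewrite scalerDr addrA yE.
Qed.

Lemma tangent_cone0 {R : realType} {n : nat} (S : set 'rV[R]_n) (y : 'rV[R]_n) :
  S y -> tangent_cone S y 0.
Proof.
move=> Sy; apply/tangent_coneP => e e0; exists (e / 2), 0.
by split; rewrite ?subrr ?normr0 ?scaler0 ?addr0 //; lra.
Qed.

Lemma dir_regular0 {R : realType} {n : nat} (S : set 'rV[R]_n)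
    (x d : 'rV[R]_n) :
  dir_regular_tangent_cone S x d 0.
Proof.
move=> t d_ _ _ St; exists (fun=> 0); split=> [|k]; first exact: cvg_cst.
exact: tangent_cone0.
Qed.

Lemma minkowski_sum_absorb {R : realType} {n : nat} (A B : set 'rV[R]_n) :
  B 0 -> (forall a b, A a -> B b -> A (a + b)) -> minkowski_sum A B = A.
Proof.
move=> B0 AB; apply/seteqP; split=> [_ [a Aa [b Bb <-]]|a Aa]; first exact: AB.
by exists a => //; exists 0; rewrite ?addr0.
Qed.

Theorem proposition1 (R : realType) (n : nat) (S : set 'rV[R]_n)
    (hS : closed S) (x : 'rV[R]_n) (hx : S x)
    (d : 'rV[R]_n) (hd : tangent_cone S x d) :
  minkowski_sum (tangent_cone (tangent_cone S x) d)
                (dir_regular_tangent_cone S x d)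
    = tangent_cone (tangent_cone S x) d
  /\ minkowski_sum (second_order_tangent_set S x d)
                   (dir_regular_tangent_cone S x d)
    = second_order_tangent_set S x d.
Proof.
split; apply: minkowski_sum_absorb; try exact: dir_regular0; move=> a v Ta Tv.
- exact: tangent_tangent_add.
- exact: second_order_add.
Qed.
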